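(* Let $n$ be an integer with $1\le n<\infty$, and let $A=\mathrm{IDD}(K^0_n,0,-1)$ be the complex algebra with basis $e_0,e_1,\ldots,e_n$ and bilinear multiplication $e_i\diamond e_j=\frac{1}{j+1}e_{i+j+1}$ if $i+j\le n-1$, and $e_i\diamond e_j=0$ otherwise. Then the space of derivations of $A$ is $$\mathfrak{Der}(A)=\langle\varphi_i : 0\le i\le n\rangle,$$ where $\varphi_i$ is the linear map with $\varphi_i(e_k)=(i+1+k)e_{k+i}$ for $0\le k\le n-i$ and $\varphi_i(e_k)=0$ for $k>n-i$.
   Context: A derivation of an algebra $(A,\diamond)$ is a linear map $D:A\to A$ with $D(a\diamond b)=D(a)\diamond b+a\diamond D(b)$ for all $a,b\in A$. $\langle S\rangle$ denotes the linear span of $S$ over $\mathbb C$. *)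

(* Defs.v *)
From HB Require Import structures.
From mathcomp Require Import all_boot all_order all_algebra.
From mathcomp Require Import classical_sets reals.
From mathcomp Require Import complex.

Set Implicit Arguments.
Unset Strict Implicit.
Unset Printing Implicit Defensive.

Import Order.TTheory GRing.Theory Num.Theory.
Local Open Scope ring_scope.
Local Open Scope classical_set_scope.

Definition is_derivation (F : fieldType) (V : vectType F) (op : V -> V -> V)
    (D : 'End(V)) : Prop :=
  forall a b : V, D (op a b) = op (D a) b + op a (D b).

Definition Der (F : fieldType) (V : vectType F) (op : V -> V -> V) :
    set 'End(V) :=
  [set D | is_derivation op D].

Section IDD.
Variables (R : realType) (n : nat).

(* The carrier of IDD(K^0_n, 0, -1): row vectors of coordinates in the basis
   e_0, ..., e_n. *)
Definition IDD : vectType R[i] := 'rV[R[i]]_n.+1.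

(* For k > n this is the zero vector. *)
Definition e (k : nat) : IDD := \row_(l < n.+1) (l == k :> nat)%:R.

(* For n >= 1 the condition i + j < n is i + j <= n - 1. *)
Definition idd_basis_mul (i j : nat) : IDD :=
  if (i + j < n)%N then (j.+1%:R)^-1 *: e (i + j + 1) else 0.

Definition idd_mul (x y : IDD) : IDD :=
  \sum_(i < n.+1) \sum_(j < n.+1) (x 0 i * y 0 j) *: idd_basis_mul i j.

Definition phi_basis (i k : nat) : IDD :=
  if (k <= n - i)%N then (i + 1 + k)%:R *: e (k + i) else 0.

Definition phi_fun (i : nat) (x : IDD) : IDD :=
  \sum_(k < n.+1) x 0 k *: phi_basis i k.

Fact phi_fun_is_linear i : linear (phi_fun i).
Proof.
move=> a x y; rewrite /phi_fun scaler_sumr -big_split /=.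
by apply: eq_bigr => k _; rewrite !mxE scalerDl scalerA.
Qed.

HB.instance Definition _ i :=
  GRing.isLinear.Build R[i] IDD IDD *:%R (phi_fun i) (phi_fun_is_linear i).

Definition phi (i : nat) : 'End(IDD) := linfun (phi_fun i).

Lemma e_delta (k : 'I_n.+1) : e k = delta_mx 0 k.
Proof. by apply/rowP => l; rewrite !mxE eqxx. Qed.

Lemma e_basis : basis_of fullv [tuple e k | k < n.+1].
Proof.
rewrite basisEdim dimvf /dim /= mul1n size_map size_enum_ord leqnn andbT.
apply/subvP => x _; rewrite [x]row_sum_delta.
apply: memv_suml => k _; rewrite memvZ // -e_delta memv_span //.
exact: map_f (mem_enum _ _).
Qed.

Lemma idd_mul_e (i j : 'I_n.+1) : idd_mul (e i) (e j) = idd_basis_mul i j.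
Proof.
rewrite /idd_mul (bigD1 i) //= (bigD1 j) //= !mxE !eqxx mulr1 scale1r.
rewrite big1 ?addr0 => [|l /negPf lj]; last first.
  by rewrite !mxE (inj_eq val_inj) lj mulr0 scale0r.
rewrite big1 ?addr0 // => k /negPf ki; rewrite big1 // => l _.
by rewrite !mxE (inj_eq val_inj) ki mul0r scale0r.
Qed.

Lemma idd_mul_linearl y : linear (idd_mul^~ y).
Proof.
move=> a x z; rewrite /idd_mul scaler_sumr -big_split /=.
apply: eq_bigr => i _; rewrite scaler_sumr -big_split /=.
by apply: eq_bigr => j _; rewrite !mxE mulrDl scalerDl scalerA mulrA.
Qed.

Lemma idd_mul_linearr x : linear (idd_mul x).
Proof.
move=> a y z; rewrite /idd_mul scaler_sumr -big_split /=.
apply: eq_bigr => i _; rewrite scaler_sumr -big_split /=.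
by apply: eq_bigr => j _; rewrite !mxE mulrDr scalerDl scalerA mulrCA.
Qed.

Lemma phi_e (i k : 'I_n.+1) : phi i (e k) = phi_basis i k.
Proof.
rewrite lfunE /= /phi_fun (bigD1 k) //= !mxE eqxx scale1r big1 ?addr0 //.
by move=> l /negPf lk; rewrite !mxE (inj_eq val_inj) lk scale0r.
Qed.

End IDD.

(* Main.v *)
Require Import Defs.
From HB Require Import structures.
From mathcomp Require Import all_boot all_order all_algebra.
From mathcomp Require Import classical_sets reals.
From mathcomp Require Import complex.
Import GRing.Theory Num.Theory.

Local Open Scope ring_scope.
Local Open Scope classical_set_scope.

(** Writing [e k] as the monomial t^k, the product of f and g is f times the
    primitive of g that vanishes at 0, taken modulo t^(n+1).  Hence
    [e k] * [e 0] = [e k.+1]: the single element [e 0] generates the algebra,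
    and a derivation is determined by its value there
    ([derivation_eq_from_e0]).  Each [phi i] is a derivation ([phi_Der]), which
    on basis vectors is the identity
    (i + k + l + 2) / (l + 1) = (i + k + 1) / (l + 1) + 1;
    since derivations are closed under linear combinations, the span of the
    [phi i] consists of derivations.  Conversely [phi i (e 0)] =
    (i + 1) [e i], and i + 1 is invertible, so any value D ([e 0]) is attained
    at [e 0] by a combination of the [phi i]; that combination is D. *)

Lemma Der_span (F : fieldType) (V : vectType F) (op : V -> V -> V)
    (opl : forall y, linear (op^~ y)) (opr : forall x, linear (op x))
    (X : seq 'End(V)) :
  {in X, forall D, is_derivation op D} ->
  {in <<X>>%VS, forall D, is_derivation op D}.
Proof.
elim: X => [|E X IH] derX D.
  rewrite span_nil memv0 => /eqP-> a b; rewrite !lfunE /=.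
  have op0l y : op 0 y = 0.
    by have := opl y (-1) 0 0; rewrite scaler0 addr0 scaleN1r addNr.
  have op0r x : op x 0 = 0.
    by have := opr x (-1) 0 0; rewrite scaler0 addr0 scaleN1r addNr.
  by rewrite op0l op0r addr0.
rewrite span_cons => /memv_addP[_ /vlineP[c ->] [G GX ->]] a b.
have derE : is_derivation op E by apply: derX; rewrite mem_head.
have derG : is_derivation op G.
  by apply: IH GX => H HX; apply: derX; rewrite in_cons HX orbT.
rewrite !lfunE /= !lfunE /= derE derG opl opr scalerDr.
by rewrite -!addrA; congr (_ + _); rewrite addrCA.
Qed.

Section IDDTheory.
Variables (R : realType) (n : nat).
Local Notation A := (IDD R n).
Local Notation mul := (@idd_mul R n).
Local Notation e := (e R n).
Local Notation phi := (phi R n).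

Lemma e_eq0 k : (n < k)%N -> e k = 0.
Proof.
move=> nk; apply/rowP => l; rewrite !mxE; case: eqP => // lk.
by move: (ltn_ord l); rewrite lk ltnS leqNgt nk.
Qed.

(** Bundling both partial products as linear maps lets the Leibniz rule be read
    as an equality of linear maps, one variable at a time, and so be tested on
    the basis. *)
Definition mull (y : A) : {linear A -> A} :=
  HB.pack (mul^~ y)
    (GRing.isLinear.Build _ _ _ _ (mul^~ y) (idd_mul_linearl y)).

Definition mulr (x : A) : {linear A -> A} :=
  HB.pack (mul x) (GRing.isLinear.Build _ _ _ _ (mul x) (idd_mul_linearr x)).

(** The truncation conditions only ever discard multiples of [e k] with k > n,
    which vanish anyway; so the product and [phi i] obey a single formula for
    all indices, and identities between them need no case analysis. *)
Lemma idd_mul_eE i j : mul (e i) (e j) = (j.+1%:R)^-1 *: e (i + j).+1.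
Proof.
have mul0v y : mul 0 y = 0 := linear0 (mull y).
have mulv0 x : mul x 0 = 0 := linear0 (mulr x).
have [lt_in|lt_ni] := ltnP i n.+1; last first.
  by rewrite (e_eq0 _ lt_ni) mul0v e_eq0 ?scaler0 // ltnS
             (leq_trans (ltnW lt_ni)) ?leq_addr.
have [lt_jn|lt_nj] := ltnP j n.+1; last first.
  by rewrite (e_eq0 _ lt_nj) mulv0 e_eq0 ?scaler0 // ltnS
             (leq_trans (ltnW lt_nj)) ?leq_addl.
rewrite (idd_mul_e R (Ordinal lt_in) (Ordinal lt_jn)) /idd_basis_mul /= addn1.
by case: ltnP => // le_n; rewrite e_eq0 ?scaler0.
Qed.

Lemma phi_eE i k : (i <= n)%N -> phi i (e k) = (i + k).+1%:R *: e (i + k).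
Proof.
move=> le_in; have [lt_kn|lt_nk] := ltnP k n.+1; last first.
  by rewrite !e_eq0 ?linear0 ?scaler0 // (leq_trans lt_nk) ?leq_addl.
rewrite (phi_e R (Ordinal (le_in : (i < n.+1)%N)) (Ordinal lt_kn)) /phi_basis /=.
rewrite addn1 addSn (addnC k); case: leqP => // lt_k.
by rewrite e_eq0 ?scaler0 // -ltn_subLR.
Qed.

Lemma e_sum (x : A) : x = \sum_(k < n.+1) x 0 k *: e k.
Proof.
rewrite [LHS]row_sum_delta; apply: eq_bigr => k _.
by rewrite e_delta.
Qed.

Lemma linear_eq_on_e (f g : {linear A -> A}) :
  (forall k, f (e k) = g (e k)) -> f =1 g.
Proof.
move=> fg x; rewrite (e_sum x) !linear_sum.
by apply: eq_bigr => k _; rewrite !linearZ /= fg.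
Qed.

Lemma derivation_on_e (D : 'End(A)) :
  (forall k l, D (mul (e k) (e l)) = mul (D (e k)) (e l) + mul (e k) (D (e l)))
  -> is_derivation mul D.
Proof.
move=> De x y; move: y.
apply: (linear_eq_on_e (D \o mulr x) (mulr (D x) \+ (mulr x \o D))) => l /=.
move: x; apply: (linear_eq_on_e (D \o mull (e l))
                                ((mull (e l) \o D) \+ mull (D (e l)))) => k.
exact: De.
Qed.

Lemma phi_Der i : (i <= n)%N -> is_derivation mul (phi i).
Proof.
move=> le_in; apply: derivation_on_e => k l.
have scl c x y : mul (c *: x) y = c *: mul x y := linearZZ (mull y) c x.
have scr c x y : mul x (c *: y) = c *: mul x y := linearZZ (mulr x) c y.
rewrite idd_mul_eE linearZ /= !phi_eE // scl scr !idd_mul_eE !scalerA.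
rewrite addnS addnA (addnCA k) addnA -scalerDl; congr (_ *: _).
rewrite mulfV ?pnatr_eq0 // -addnS -addSn natrD mulrDr mulrC.
by rewrite [X in _ + X]mulVf ?pnatr_eq0.
Qed.

(** Since [e k.+1] is the product of [e k] and [e 0], the Leibniz rule computes
    the value at [e k.+1] from the values at [e k] and [e 0]. *)
Lemma derivation_eq_from_e0 (D E : 'End(A)) :
  is_derivation mul D -> is_derivation mul E -> D (e 0) = E (e 0) -> D = E.
Proof.
move=> derD derE DE0.
suff DE k : D (e k) = E (e k) by apply/lfunP; apply: (linear_eq_on_e D E).
elim: k => // k DEk.
have -> : e k.+1 = mul (e k) (e 0) by rewrite idd_mul_eE invr1 scale1r addn0.
by rewrite derD derE DEk DE0.
Qed.

End IDDTheory.

Theorem theorem3p4 (R : realType) (n : nat) (hn : (1 <= n)%N) :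
  Der (@idd_mul R n) =
  [set` <<[seq phi R n i | i <- iota 0 n.+1]>>%VS].
Proof.
have span_Der : {in <<[seq phi R n i | i <- iota 0 n.+1]>>%VS,
    forall D, is_derivation (@idd_mul R n) D}.
  apply: (Der_span _ _ _ (@idd_mul_linearl R n) (@idd_mul_linearr R n)).
  move=> _ /mapP[i + ->].
  by rewrite mem_iota ltnS => /andP[_]; apply: phi_Der.
apply/seteqP; split=> D /=; last exact: span_Der.
move=> derD.
(* The coefficients are forced by phi i (e 0) = (i + 1) e i. *)
pose E := \sum_(i < n.+1) (D (e R n 0) 0 i / i.+1%:R) *: phi R n i.
have E_span : E \in <<[seq phi R n i | i <- iota 0 n.+1]>>%VS.
  apply: memv_suml => i _; apply/memvZ/memv_span/map_f.
  by rewrite mem_iota ltn_ord.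
suff -> : D = E by [].
apply: derivation_eq_from_e0 => //; first exact: span_Der.
rewrite [LHS]e_sum sum_lfunE; apply: eq_bigr => i _.
have le_in : (i <= n)%N by rewrite -ltnS.
by rewrite scale_lfunE phi_eE // addn0 scalerA divfK ?pnatr_eq0.
Qed.
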